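(* Let $\Lambda$ be an $m$-tuple of distinct complex numbers, let $n$ be a natural number, and let $\Lambda'$ be a generic $m$-tuple. Then $|\mathcal{D}_n(\Lambda)|\le|\mathcal{D}_n(\Lambda')|$, and equality holds if and only if $\mathcal{D}_n(\Lambda)=\mathcal{D}_n(\Lambda')$.
   Context: For a polynomial $P\in\mathbb{C}[x]$ of degree $n$ and an $m$-tuple $\Lambda=(\lambda_1,\dots,\lambda_m)$ of distinct complex numbers, the dope matrix of $P$ with respect to $\Lambda$ is the $m\times(n+1)$ matrix $D_P(\Lambda)=(\delta_{ij})_{i\in[1,m],\,j\in[0,n]}$, where $\delta_{ij}=1$ if $P^{(j)}(\lambda_i)=0$ and $\delta_{ij}=0$ otherwise ($P^{(j)}$ denotes the $j$-th derivative). $\mathcal{D}_n(\Lambda)=\{D_P(\Lambda):P\in\mathbb{C}[x],\ \deg P=n\}$. An $m$-tuple in $\mathbb{C}^m$ is generic if its entries satisfy no nontrivial polynomial relation with integer coefficients (i.e., they are algebraically independent over $\mathbb{Q}$); the set $\mathcal{D}_n(\Lambda')$ is the same for all generic $m$-tuples $\Lambda'$, and the paper denotes it $\mathcal{D}_n^{\mathrm{gen}(m)}$. *)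

(* Defs.v *)
From HB Require Import structures.
From mathcomp Require Import all_boot all_order all_algebra.
From mathcomp Require Import boolp reals complex.
From mathcomp Require Import mpoly.

Set Implicit Arguments.
Unset Strict Implicit.
Unset Printing Implicit Defensive.

Import GRing.Theory.
Local Open Scope ring_scope.

(* The complex numbers are [R[i]] with [R : realType]. *)

(* Entry [true] stands for 1, [false] for 0. The number of columns is fixed by
   [n], so this is the dope matrix of [P] only when [P] has degree [n]. *)
Definition dope_matrix (R : realType) (m n : nat) (L : m.-tuple R[i])
    (P : {poly R[i]}) : 'M[bool]_(m, n.+1) :=
  \matrix_(i < m, j < n.+1) ((P^`(j)).[tnth L i] == 0).

(* [size P = n.+1] says that [P] has degree exactly [n]. *)
Definition dope_set (R : realType) (n m : nat) (L : m.-tuple R[i]) :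
    {set 'M[bool]_(m, n.+1)} :=
  [set D | `[< exists P : {poly R[i]}, size P = n.+1 /\ D = dope_matrix n L P >]].

Definition generic (R : realType) (m : nat) (L : m.-tuple R[i]) : Prop :=
  forall p : {mpoly int[m]}, (map_mpoly intr p).@[tnth L] = 0 -> p = 0.

(* Main.v *)
(* The functionals P |-> P^(j)(lambda_i) on polynomials of degree at most n form
   a vector configuration, and the dope matrices of degree n polynomials are its
   flats that avoid the leading-coefficient functional. A set of functionals
   which is independent at L stays independent at the generic L', since a
   nonzero minor at L is a nonzero integer polynomial. Hence, if B is a basis of
   a flat S at L, the closure T of B at L' is contained in S, and S is the
   closure of T at L; so S |-> T is injective. *)
Require Import Defs.
From mathcomp Require Import all_boot all_order all_algebra.
From mathcomp Require Import boolp reals complex mpoly.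

Set Implicit Arguments.
Unset Strict Implicit.
Unset Printing Implicit Defensive.

Import GRing.Theory Num.Theory.
Local Open Scope ring_scope.

(** * Flats of a finite vector configuration *)

Section ZeroSets.

Variables (F : numFieldType) (E : finType) (d : nat).
Implicit Types (a b : E -> 'rV[F]_d) (s t : seq E) (S : {set E}).

Definition zero_set a (v : 'cV[F]_d) : {set E} := [set x | a x *m v == 0].

(** The flats of [a] that avoid [e]: by [lin_closure_zero_set] and [extend_to_basis], zero sets and
    linear closures are the same sets. *)
Definition zero_sets (e : E) a : {set {set E}} :=
  [set S | `[< exists v, S = zero_set a v >] & e \notin S].

Definition lin_closure a s : {set E} := [set x | a x \in <<map a s>>%VS].

Lemma poly_nonroot (p : {poly F}) : p != 0 -> exists c, p.[c] != 0.
Proof.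
move=> p0; apply: contrapT => /forallNP h.
have := @max_poly_roots _ p [seq i%:R | i <- iota 0 (size p)] p0.
rewrite size_map size_iota ltnn => noroots; suff : false by [].
apply: noroots.
  by apply/allP => c _; apply/negPn/negP/h.
by rewrite map_inj_uniq ?iota_uniq // => i j /eqP; rewrite eqr_nat => /eqP.
Qed.

(** Take [u] on the moment curve, [u = (1, c, c^2, ...)]: then [a x *m u] is the value at [c] of the
    polynomial with coefficients [a x], and [c] is chosen off the roots of all the nonzero ones. *)
Lemma exists_vec_avoiding a :
  exists u : 'cV[F]_d, forall x, a x *m u = 0 -> a x = 0.
Proof.
pose q x := rVpoly (a x).
have pn0 : \prod_(x | q x != 0) q x != 0 by apply/prodf_neq0.
have [c] := poly_nonroot pn0.
rewrite horner_prod => /prodf_neq0 hc; exists (\col_i c ^+ i) => x hx.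
apply: contrapT => /eqP ax0.
have qx0 : q x != 0.
  by apply: contraNneq ax0 => q0; rewrite -[a x]rVpolyK -/(q x) q0 linear0.
have /negP[] := hc x qx0.
rewrite (horner_coef_wide _ (size_poly _ _)).
move/matrixP/(_ 0 0): hx; rewrite !mxE => hx; apply/eqP; rewrite -[RHS]hx.
by apply: eq_bigr => i _; rewrite mxE coef_rVpoly_ord.
Qed.

Lemma mem_span_rows k (X : k.-tuple 'rV[F]_d) (u : 'rV[F]_d) :
  (u \in <<X>>%VS) = (u <= \matrix_(i < k) X`_i)%MS.
Proof.
apply/idP/idP => [/coord_span ->|/submxP[w ->]].
  apply: summx_sub => i _; apply: scalemx_sub.
  by apply: (eq_row_sub i); rewrite rowK.
rewrite mulmx_sum_row; apply: memv_suml => i _.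
by rewrite rowK; apply/memvZ/memv_span/mem_nth; rewrite size_tuple.
Qed.

Lemma free_row_free k (X : k.-tuple 'rV[F]_d) :
  free X = row_free (\matrix_(i < k) X`_i).
Proof.
apply/freeP/idP => [fX|fM c c0 i].
  rewrite -kermx_eq0; apply/rowV0P => w /sub_kermxP wM.
  apply/rowP => i; rewrite mxE; apply: (fX (w 0)).
  by rewrite -[RHS]wM mulmx_sum_row; apply: eq_bigr => j _; rewrite rowK.
have : (\row_i c i) *m (\matrix_(i < k) X`_i) = 0 *m (\matrix_(i < k) X`_i).
  rewrite mul0mx mulmx_sum_row -[RHS]c0.
  by apply: eq_bigr => j _; rewrite rowK mxE.
by move/(row_free_inj fM)/rowP/(_ i); rewrite !mxE.
Qed.

(** Multiplication by [cokermx M] kills exactly the span of [s]; a vector [u] avoiding the nonzero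
    images turns this into a single functional. *)
Lemma lin_closure_zero_set a s : exists v, lin_closure a s = zero_set a v.
Proof.
pose X := map_tuple a (in_tuple s); pose M := \matrix_(i < size s) X`_i.
have [u hu] := exists_vec_avoiding (fun x => a x *m cokermx M).
exists (cokermx M *m u); apply/setP => x; rewrite !inE (mem_span_rows X).
rewrite submxE (mulmxA (a x) (cokermx M)).
by apply/eqP/eqP => [->|/hu //]; rewrite mul0mx.
Qed.

Lemma sub_lin_closure a s : {subset s <= lin_closure a s}.
Proof. by move=> x xs; rewrite inE memv_span ?map_f. Qed.

Lemma lin_closureS a s t :
  {subset s <= lin_closure a t} -> lin_closure a s \subset lin_closure a t.
Proof.
move=> h; apply/subsetP => x; rewrite !inE; apply/subvP/span_subvP.
by move=> _ /mapP[y /h yt ->]; rewrite inE in yt.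
Qed.

Lemma zero_set_closed a v s :
  {subset s <= zero_set a v} -> lin_closure a s \subset zero_set a v.
Proof.
move=> h; apply/subsetP => x; rewrite !inE.
rewrite (mem_span_rows (map_tuple a (in_tuple s))) => /submxP[w ->].
rewrite -mulmxA (_ : _ *m v = 0) ?mulmx0 //.
apply/row_matrixP => i; rewrite row_mul rowK row0.
have := h _ (mem_tnth i (in_tuple s)).
by rewrite inE -tnth_nth tnth_map => /eqP.
Qed.

(** Greedy extension, which stops because a free family has at most [d] members. The prescribed
    start [s] later gives a basis through a chosen element. *)
Lemma extend_to_basis a v s :
    {subset s <= zero_set a v} -> free (map a s) ->
  exists t,
    [/\ {subset s <= t}, free (map a t) & lin_closure a t = zero_set a v].
Proof.
have [k] := ubnP (d - size s)%N; elim: k s => // k IH s sk sS sf.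
have [sub|/subsetPn[x xS xs]] := boolP (zero_set a v \subset lin_closure a s).
  by exists s; split=> //; apply/eqP; rewrite eqEsubset zero_set_closed.
have xf : free (map a (x :: s)).
  by rewrite /= free_cons sf andbT; rewrite inE in xs.
have xd : (size s < d)%N.
  have := xf; rewrite (free_row_free (map_tuple a (in_tuple (x :: s)))) => /eqP.
  by rewrite -[(size s).+1]/(size (x :: s)) => {1}<-; apply: rank_leq_col.
have [||t [st tf tE]] := IH (x :: s) _ _ xf.
- by move: sk => /=; rewrite !ltnS; apply: leq_trans; rewrite ltn_sub2l.
- by move=> y; rewrite inE => /predU1P[->|/sS].
by exists t; split=> // y ys; apply: st; rewrite inE ys orbT.
Qed.

(** * Comparison with a configuration [b] in more general position than [a] *)

Section WeakMap.

Variables a b : E -> 'rV[F]_d.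
Hypothesis freeW : forall s, free (map a s) -> free (map b s).

Lemma lin_closure_weak s :
  free (map a s) -> lin_closure b s \subset lin_closure a s.
Proof.
move=> sf; apply/subsetP => x; rewrite !inE; apply: contraLR => xs.
have /freeW : free (map a (x :: s)) by rewrite /= free_cons xs.
by rewrite /= free_cons => /andP[].
Qed.

(** The family [s] lies in its own closure at [b], hence in that of [t] at [b], hence in that of [t]
    at [a]; then exchange [s] and [t]. *)
Lemma lin_closure_weak_inj s t : free (map a s) -> free (map a t) ->
  lin_closure b s = lin_closure b t -> lin_closure a s = lin_closure a t.
Proof.
have sub r r' : free (map a r') ->
    lin_closure b r = lin_closure b r' ->
    lin_closure a r \subset lin_closure a r'.
  move=> r'f e; apply: lin_closureS => x /(sub_lin_closure b); rewrite e.
  exact/subsetP/lin_closure_weak.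
by move=> sf tf e; apply/eqP; rewrite eqEsubset !sub.
Qed.

Lemma zero_sets_weak (e : E) :
  exists2 B : {set E} -> seq E,
    {in zero_sets e a, forall S, free (map a (B S)) /\ lin_closure a (B S) = S} &
    {in zero_sets e a &, injective (lin_closure b \o B)} /\
    (lin_closure b \o B) @: zero_sets e a \subset zero_sets e b.
Proof.
have /choice[B hB] S : exists s,
    S \in zero_sets e a -> free (map a s) /\ lin_closure a s = S.
  have [|/negP nS] := boolP (S \in zero_sets e a); last by exists [::].
  rewrite inE => /andP[/asboolP[v ->] _].
  have [||t [_ tf tE]] := @extend_to_basis a v [::] => //; first exact: nil_free.
  by exists t.
exists B => //; split=> [S T /hB[Sf SE] /hB[Tf TE] /= eST|].
  by rewrite -SE -TE; apply: lin_closure_weak_inj.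
apply/subsetP => _ /imsetP[S SZ ->]; have [Sf SE] := hB _ SZ.
rewrite inE /=; apply/andP; split.
  exact/asboolP/lin_closure_zero_set.
move: SZ; rewrite inE => /andP[_]; apply: contra.
by rewrite -{2}SE; apply/subsetP/lin_closure_weak.
Qed.

Lemma card_zero_sets_weak (e : E) : (#|zero_sets e a| <= #|zero_sets e b|)%N.
Proof.
have [B _ [Binj Bsub]] := zero_sets_weak e.
by rewrite -(card_in_imset Binj) subset_leq_card.
Qed.

(* If the injection [S |-> lin_closure b (B S)] is onto, then
   [lin_closure b s] is the same for all [a]-bases [s] of [S]; every element of
   [S] lies in such a basis, so this common value is [S] itself. *)
Lemma eq_card_zero_sets_weak (e : E) : (forall x, a x != 0) ->
  #|zero_sets e a| = #|zero_sets e b| -> zero_sets e a = zero_sets e b.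
Proof.
move=> a0 eqc; have [B hB [Binj Bsub]] := zero_sets_weak e.
have BE : (lin_closure b \o B) @: zero_sets e a = zero_sets e b.
  by apply/eqP; rewrite eqEcard Bsub card_in_imset // eqc leqnn.
apply/eqP; rewrite eqEcard eqc leqnn andbT; apply/subsetP => S SZ.
have [Sf SE] := hB _ SZ.
suff -> : S = lin_closure b (B S).
  by rewrite -BE; apply/imsetP; exists S.
apply/eqP; rewrite eqEsubset -{4}SE lin_closure_weak // andbT.
apply/subsetP => x xS.
have := SZ; rewrite inE => /andP[/asboolP[v Sv] eS].
have [||s [xs sf sE]] := @extend_to_basis a v [:: x].
- by move=> y; rewrite inE => /eqP ->; rewrite -Sv.
- by rewrite /= seq1_free.
have : lin_closure b s \in zero_sets e b.
  rewrite inE; apply/andP; split; first exact/asboolP/lin_closure_zero_set.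
  apply: contra eS; rewrite Sv -sE; exact/subsetP/lin_closure_weak.
rewrite -BE => /imsetP[T TZ /= eT]; have [Tf TE] := hB _ TZ.
have TS : T = S by rewrite Sv -sE -TE; apply: lin_closure_weak_inj.
by rewrite -TS -eT; apply/sub_lin_closure/xs/mem_head.
Qed.

End WeakMap.

End ZeroSets.

(** * Independence at a generic point *)

Section Specialization.

Variables (R : realType) (m d : nat) (E : finType).
Variable q : E -> 'I_d -> {mpoly int[m]}.

Definition spec_vec (L : m.-tuple R[i]) (x : E) : 'rV[R[i]]_d :=
  \row_k (map_mpoly intr (q x k)).@[tnth L].

(* An independent family has a nonvanishing maximal minor at [L]; that minor is
   a nonzero integer polynomial, so it does not vanish at a generic point. *)
Lemma free_spec_generic (L L' : m.-tuple R[i]) (s : seq E) :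
  generic L' -> free (map (spec_vec L) s) -> free (map (spec_vec L') s).
Proof.
move=> gen; pose X K := map_tuple (spec_vec K) (in_tuple s).
rewrite (free_row_free (X L)) (free_row_free (X L')).
pose M K := \matrix_(i < size s) (X K)`_i; rewrite -!/(M _) => fM.
(* [fullrankfun] selects rows, so the transpose is used to select columns [f] of an invertible minor
   at [L]; the same [f] serves at [L']. *)
have fMT : row_full (M L)^T by rewrite /row_full mxrank_tr.
pose f := fullrankfun fMT.
pose Q := \matrix_(i, j) q (tnth (in_tuple s) i) (f j).
pose ev K (p : {mpoly int[m]}) : R[i] := (map_mpoly intr p).@[tnth K].
have evQ K : ev K (\det Q) = \det (colsub f (M K)).
  rewrite /ev -2!det_map_mx; congr (\det _); apply/matrixP => i j.
  by rewrite !mxE -tnth_nth tnth_map mxE.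
have Q0 : \det Q != 0.
  apply: contraTneq (fullrowsub_unit fMT) => Q0.
  by rewrite unitmxE -det_tr trmx_mxsub trmxK -evQ Q0 /ev !raddf0 unitr0.
have : colsub f (M L') \in unitmx.
  by rewrite unitmxE unitfE -evQ; apply: contra Q0 => /eqP/gen ->.
rewrite -row_free_unit -[M L']mulmx1 -mulmx_colsub mulmx1 => /eqP rk.
by rewrite /row_free eqn_leq rank_leq_row -[X in (X <= _)%N]rk mxrankM_maxl.
Qed.

End Specialization.

(** * Dope matrices as flats of derivative functionals *)

Section DopeMatrices.

Variables (R : realType) (m n : nat).
Implicit Types L : m.+1.-tuple R[i].

Let E : finType := ('I_m.+1 * 'I_n.+1)%type.

(** The derivative of order [x.2] of [X^k] at the variable of index [x.1]. For [k < x.2] the falling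
    factorial is 0, so the truncated exponent is harmless. *)
Definition deriv_coef (x : E) (k : 'I_n.+1) : {mpoly int[m.+1]} :=
  'X_(x.1) ^+ (k - x.2) *+ k ^_ x.2.

Definition deriv_vec L : E -> 'rV[R[i]]_n.+1 := spec_vec deriv_coef L.

Lemma deriv_vecE L x k : deriv_vec L x 0 k = ('X^k)^`(x.2).[tnth L x.1].
Proof.
rewrite mxE derivnXn hornerMn hornerXn /deriv_coef.
by rewrite !raddfMn /= !rmorphXn /= map_mpolyX mevalXU.
Qed.

Lemma deriv_vec_neq0 L x : deriv_vec L x != 0.
Proof.
(* The coordinate of index [x.2] is the factorial of [x.2]. *)
apply/eqP => /rowP/(_ x.2); rewrite deriv_vecE mxE derivnXn hornerMn hornerXn.
by rewrite subnn expr0 ffactnn => /eqP; rewrite pnatr_eq0 eqn0Ngt fact_gt0.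
Qed.

Lemma deriv_vec_mul L x (v : 'cV[R[i]]_n.+1) :
  deriv_vec L x *m v = (((rVpoly v^T)^`(x.2)).[tnth L x.1])%:M.
Proof.
apply/rowP => i; rewrite ord1 mxE [RHS]mxE eqxx mulr1n.
rewrite [rVpoly _]poly_def raddf_sum horner_sum; apply: eq_bigr => k _.
rewrite insubT // => kn; rewrite /= derivnZ hornerZ deriv_vecE mulrC !mxE.
by congr (v _ _ * _); apply: val_inj.
Qed.

Definition set_of_dope (D : 'M[bool]_(m.+1, n.+1)) : {set E} :=
  [set x | D x.1 x.2].

Lemma set_of_dope_inj : injective set_of_dope.
Proof.
move=> D D' /setP eD; apply/matrixP => i j.
by have := eD (i, j); rewrite !inE.
Qed.

(** For degree at most [n], the [n]-th derivative is the constant [n!] times the coefficient of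
    [X^n], so avoiding [(ord0, ord_max)] means having degree exactly [n]. *)
Lemma zero_sets_dope L :
  zero_sets (ord0, ord_max) (deriv_vec L) = set_of_dope @: dope_set n L.
Proof.
have zeroE v :
    zero_set (deriv_vec L) v = set_of_dope (dope_matrix n L (rVpoly v^T)).
  apply/setP => x; rewrite !inE deriv_vec_mul mxE.
  by apply/eqP/eqP => [/matrixP/(_ 0 0)|->]; rewrite ?raddf0 // !mxE.
have sizeE (P : {poly R[i]}) : (size P <= n.+1)%N ->
    (size P == n.+1) = ((ord0, ord_max) \notin set_of_dope (dope_matrix n L P)).
  move=> sP; rewrite inE mxE /=.
  have -> : P^`(n) = (P`_n *+ n`!)%:P.
    apply/polyP => k; rewrite coef_derivn coefC; case: k => [|k] /=.
      by rewrite addn0 ffactnn.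
    by rewrite nth_default ?mul0rn // addnS (leq_trans sP) // ltnS leq_addr.
  rewrite hornerC mulrn_eq0 negb_or -lt0n fact_gt0 /=.
  apply/eqP/idP => [sE|].
    by rewrite -[n]/(n.+1.-1) -sE -lead_coefE lead_coef_eq0 -size_poly_gt0 sE.
  by apply: contraNeq => sE; rewrite nth_default // -ltnS ltn_neqAle sE.
apply/setP => S; apply/idP/imsetP.
  rewrite inE => /andP[/asboolP[v ->]]; rewrite zeroE -sizeE ?size_poly //.
  move/eqP=> sP; exists (dope_matrix n L (rVpoly v^T)) => //.
  by rewrite inE; apply/asboolP; exists (rVpoly v^T).
case=> D; rewrite inE => /asboolP[P [sP ->]] ->; rewrite inE -sizeE ?sP //.
rewrite eqxx andbT; apply/asboolP; exists (poly_rV P)^T.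
by rewrite zeroE trmxK poly_rV_K // sP.
Qed.

End DopeMatrices.

Local Close Scope ring_scope.

Theorem theorem1p6 (R : realType) (m n : nat) (L L' : m.-tuple R[i]%C)
    (distinct_L : uniq L) (generic_L' : generic L') :
  #|dope_set n L| <= #|dope_set n L'| /\
  (#|dope_set n L| = #|dope_set n L'| <-> dope_set n L = dope_set n L').
Proof.
case: m L L' distinct_L generic_L' => [|k] L L' _ gen.
  (* Without points there is no index [ord0] to carry the leading coefficient, but both tuples are
     empty. *)
  by rewrite (tuple0 L) (tuple0 L').
have freeW s := @free_spec_generic _ _ _ _ (@deriv_coef k n) L L' s gen.
rewrite -!(card_imset _ (@set_of_dope_inj k n)) -!zero_sets_dope.
split; first exact: card_zero_sets_weak.
split=> [eqc|]; last by rewrite !zero_sets_dope => ->.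
apply: (imset_inj (@set_of_dope_inj k n)); rewrite -!zero_sets_dope.
exact: eq_card_zero_sets_weak (deriv_vec_neq0 L) eqc.
Qed.
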